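(* Let $m$ be a non-negative integer, let $c_0,c_1,\dots,c_m\in\mathbb{C}$, let $a,x$ be non-zero complex numbers, and let $\lambda\in\mathbb{C}$ satisfy $\lambda\neq 0$ and $(\lambda;\lambda)_m\neq 0$. Then $$c_0+\frac{c_1}{x}+\cdots+\frac{c_m}{x^m}=\sum_{k=0}^{m}\left(\sum_{i=k}^{m}\frac{c_i}{a^i}\genfrac{[}{]}{0pt}{}{i}{k}_{\lambda}\right)(-1)^k\lambda^{\binom{k}{2}}(x-a)_\lambda^k.$$
   Context: $(x-a)_\lambda^0=1$ and $(x-a)_\lambda^k=\prod_{j=0}^{k-1}\left(1-\frac{a}{\lambda^j x}\right)$ for $k\ge 1$ (not an ordinary power). $(q;q)_0=1$, $(q;q)_m=\prod_{j=1}^m(1-q^j)$, and the $q$-binomial coefficient is $\genfrac{[}{]}{0pt}{}{i}{k}_{q}=\frac{(q;q)_i}{(q;q)_k(q;q)_{i-k}}$. *)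

(* Defs.v *)
From HB Require Import structures.
From mathcomp Require Import all_boot all_order all_algebra.
From mathcomp Require Import reals complex.
Set Implicit Arguments.
Unset Strict Implicit.
Unset Printing Implicit Defensive.
Import GRing.Theory.
Local Open Scope ring_scope.

(* [(q; q)_m]; the index [j < m] stands for the factor [1 - q ^ (j + 1)]. *)
Definition qpochhammer (F : fieldType) (q : F) (m : nat) : F :=
  \prod_(j < m) (1 - q ^+ j.+1).

(* Meaningful for [k <= i] and [(q; q)_i != 0]: elsewhere [i - k] is truncated
   or the denominator may vanish. *)
Definition qbinomial (F : fieldType) (q : F) (i k : nat) : F :=
  qpochhammer q i / (qpochhammer q k * qpochhammer q (i - k)).

(* [(x - a)_l^k], which is not an ordinary power. *)
Definition lpower (F : fieldType) (l x a : F) (k : nat) : F :=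
  \prod_(j < k) (1 - a / (l ^+ j * x)).

(* Main.v *)
Require Import Defs.
From HB Require Import structures.
From mathcomp Require Import all_boot all_order all_algebra.
From mathcomp Require Import reals complex.
From mathcomp Require Import ring.
Set Implicit Arguments.
Unset Strict Implicit.
Unset Printing Implicit Defensive.
Import GRing.Theory.
Local Open Scope ring_scope.

(** Both sides are linear in the [c i], so it suffices to expand [t ^+ i], for
    [t = a / x], in the basis [P_k(t) = \prod_(j < k) (t - lambda ^+ j)]; this
    product absorbs the factors [(-1) ^+ k * lambda ^+ 'C(k, 2)].  Since
    [t P_k = P_(k.+1) + lambda ^+ k P_k], the coefficients obey the q-Pascal
    recurrence, hence are the q-binomial coefficients. *)

Section QBinomial.
Variables (F : fieldType) (q : F).

Lemma qpochhammerS n :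
  qpochhammer q n.+1 = qpochhammer q n * (1 - q ^+ n.+1).
Proof. by rewrite /qpochhammer big_ord_recr. Qed.

(** [(q; q)_i] is an initial part of the product [(q; q)_n], so one hypothesis at the top index
    clears every denominator below it. *)
Lemma qpochhammer_neq0_le i n :
  (i <= n)%N -> qpochhammer q n != 0 -> qpochhammer q i != 0.
Proof.
move=> /subnKC <-; rewrite /qpochhammer big_split_ord /= mulf_eq0 negb_or.
by case/andP.
Qed.

Lemma qbinomial0 n : qpochhammer q n != 0 -> qbinomial q n 0 = 1.
Proof.
by move=> n0; rewrite /qbinomial subn0 {2}/qpochhammer big_ord0 mul1r divff.
Qed.

Lemma qbinomialnn n : qpochhammer q n != 0 -> qbinomial q n n = 1.
Proof.
by move=> n0; rewrite /qbinomial subnn {3}/qpochhammer big_ord0 mulr1 divff.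
Qed.

(** Over a common denominator this is [1 - u v = (1 - u) + u (1 - v)] with [u = q ^+ k.+1] and
    [v = q ^+ (n - k)]. The case [k = n] is left out: [n - n.+1] truncates to [0], so
    [qbinomial q n n.+1] need not vanish. *)
Lemma qbinomialS n k : (k < n)%N -> qpochhammer q n != 0 ->
  qbinomial q n.+1 k.+1 = qbinomial q n k + q ^+ k.+1 * qbinomial q n k.+1.
Proof.
move=> lt_kn n0; have [d def_n] : exists d, n = (k.+1 + d)%N.
  by exists (n - k.+1)%N; rewrite subnKC.
have k0 := qpochhammer_neq0_le lt_kn n0.
have d0 : qpochhammer q d.+1 != 0.
  by apply: qpochhammer_neq0_le n0; rewrite def_n addSn ltnS leq_addl.
rewrite /qbinomial subSS.
have -> : (n - k = d.+1)%N by rewrite def_n addSnnS addKn.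
have -> : (n - k.+1 = d)%N by rewrite def_n addKn.
have -> : qpochhammer q n.+1
    = qpochhammer q n * (1 - q ^+ k.+1 * q ^+ d.+1).
  by rewrite qpochhammerS -exprD def_n addnS.
move: k0 d0; rewrite !qpochhammerS !mulf_eq0 !negb_or.
move: (q ^+ k.+1) (q ^+ d.+1) => u v /andP[k0 u1] /andP[d0 v1].
by field; rewrite k0 u1 d0 v1.
Qed.

Lemma expr_qbinomial t n : qpochhammer q n != 0 ->
  t ^+ n = \sum_(k < n.+1) qbinomial q n k * \prod_(j < k) (t - q ^+ j).
Proof.
elim: n => [|n IHn] n1.
  by rewrite big_ord1 qbinomial0 // big_ord0 mulr1.
have n0 := qpochhammer_neq0_le (leqnSn n) n1.
set P := fun k : nat => \prod_(j < k) (t - q ^+ j).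
have PS k : t * P k = P k.+1 + q ^+ k * P k.
  by rewrite /P big_ord_recr /=; ring.
rewrite exprS IHn // mulr_sumr.
under eq_bigr => k _ do rewrite mulrCA -/(P k) PS mulrDr.
(* The end terms [P 0] and [P n.+1] are split off on both sides, so that q-Pascal is applied only at
   the indices from [1] to [n]. *)
rewrite big_split /= big_ord_recr /= [X in _ + X]big_ord_recl /=.
rewrite [RHS]big_ord_recl big_ord_recr /= !qbinomial0 // !qbinomialnn //.
under [X in _ = _ + (X + _)]eq_bigr => k _.
  rewrite /bump /= add1n qbinomialS // mulrDl -/(P k.+1); over.
rewrite big_split /= expr0 !mul1r -/(P 0) -/(P n.+1).
rewrite [X in _ + (_ + X)](_ : _ = \sum_(i < n)
    q ^+ i.+1 * qbinomial q n i.+1 * P i.+1); first by ring.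
by apply: eq_bigr => i _; rewrite /bump /= add1n mulrCA mulrA.
Qed.

(** Factor by factor, [- q ^+ j * (1 - a / (q ^+ j * x)) = a / x - q ^+ j], and the exponents
    [j < k] add up to ['C(k, 2)]. *)
Lemma lpowerE x a k : q != 0 ->
  (-1) ^+ k * q ^+ 'C(k, 2) * lpower q x a k = \prod_(j < k) (a / x - q ^+ j).
Proof.
move=> q0; elim: k => [|k IHk].
  by rewrite /lpower !big_ord0 !mulr1.
rewrite big_ord_recr /= -IHk /lpower big_ord_recr /= binS bin1 exprD exprS.
have qk0 : q ^+ k != 0 by rewrite expf_neq0.
by rewrite invfM; move: (x^-1) => y; field.
Qed.

End QBinomial.

Theorem theorem6 (R : realType) (m : nat) (c : 'I_m.+1 -> R[i])
    (a x lambda : R[i])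
    (ha : a != 0) (hx : x != 0) (hlambda : lambda != 0)
    (hpoch : qpochhammer lambda m != 0) :
  \sum_(i < m.+1) c i / x ^+ i =
  \sum_(k < m.+1)
    (\sum_(i < m.+1 | (k <= i)%N) c i / a ^+ i * qbinomial lambda i k)
    * (-1) ^+ k * lambda ^+ 'C(k, 2) * lpower lambda x a k.
Proof.
under [RHS]eq_bigr => k _ do
  rewrite -mulrA -mulrA [X in _ * X]mulrA lpowerE // mulr_suml.
(* With [i] outermost, the claim can be checked on each [c i] separately. *)
rewrite (exchange_big_dep xpredT) //=; apply: eq_bigr => i _.
have i0 : qpochhammer lambda i != 0.
  by apply: qpochhammer_neq0_le hpoch; rewrite -ltnS.
under eq_bigr => k _ do rewrite -mulrA.
rewrite -mulr_sumr.
(* The condition [k <= i] cuts the range [k < m.+1] down to [k < i.+1], as in the expansion of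
   [(a / x) ^+ i]. *)
have := @big_ord_widen _ 0 +%R _ m.+1
  (fun k => qbinomial lambda i k * \prod_(j < k) (a / x - lambda ^+ j))
  (ltn_ord i).
rewrite /= -(expr_qbinomial (a / x) i0) => <-.
by rewrite expr_div_n mulrA divfK // expf_neq0.
Qed.
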